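(* Let $k\ge 1$ be an integer. For every polynomial $h(x)\in\mathbb{C}_p[x]$, $$\Biggl\langle\int_{\mathbb{Z}_p}\cdots\int_{\mathbb{Z}_p}w^{a_1+\cdots+a_k}e^{(a_1+\cdots+a_k)t}\prod_{j=1}^k\mathrm{d}\mu_{-1}(a_j)\Bigg|h(x)\Biggr\rangle=\int_{\mathbb{Z}_p}\cdots\int_{\mathbb{Z}_p}w^{a_1+\cdots+a_k}h(a_1+\cdots+a_k)\prod_{j=1}^k\mathrm{d}\mu_{-1}(a_j).$$ Furthermore, $$\Biggl\langle\biggl(\frac{2}{we^{t}+1}\biggr)^k\Bigg|h(x)\Biggr\rangle=\int_{\mathbb{Z}_p}\cdots\int_{\mathbb{Z}_p}w^{a_1+\cdots+a_k}h(a_1+\cdots+a_k)\prod_{j=1}^k\mathrm{d}\mu_{-1}(a_j);$$ equivalently, for every $n\ge 0$, $$E_{n,w}^{(k)}=\Biggl\langle\int_{\mathbb{Z}_p}\cdots\int_{\mathbb{Z}_p}w^{a_1+\cdots+a_k}e^{(a_1+\cdots+a_k)t}\prod_{j=1}^k\mathrm{d}\mu_{-1}(a_j)\Bigg|x^n\Biggr\rangle.$$ All multiple integrals are $k$-fold.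
   Context: Let $p$ be a fixed odd prime, $\mathbb{C}_p$ the completion of an algebraic closure of $\mathbb{Q}_p$ with absolute value normalized by $|p|_p=p^{-1}$, and let $w\in\mathbb{C}_p$ satisfy $|1-w|_p<1$. For a uniformly differentiable function $F:\mathbb{Z}_p\to\mathbb{C}_p$, the fermionic $p$-adic integral is $\int_{\mathbb{Z}_p}F(a)\,\mathrm{d}\mu_{-1}(a)=\lim_{N\to\infty}\sum_{a=0}^{p^N-1}F(a)(-1)^a$. Multiple integrals are iterated integrals; when the integrand is a formal power series in $t$ whose coefficients depend on the $a_j$, the integral is taken coefficientwise (with $e^{(a_1+\cdots+a_k)t}=\sum_{n\ge0}(a_1+\cdots+a_k)^n\frac{t^n}{n!}$). The weighted Euler polynomials of order $k$, $E_{n,w}^{(k)}(x)$ ($n\ge 0$), are defined by the formal power series identity $\bigl(\frac{2}{we^t+1}\bigr)^ke^{xt}=\sum_{n=0}^\infty E_{n,w}^{(k)}(x)\frac{t^n}{n!}$, and the weighted Euler numbers of order $k$ are $E_{n,w}^{(k)}=E_{n,w}^{(k)}(0)$. A formal power series $f(t)=\sum_{m\ge 0}c_m\frac{t^m}{m!}$ with coefficients in $\mathbb{C}_p$ acts as a linear functional on $\mathbb{C}_p[x]$ by $\langle f(t)|x^n\rangle=c_n$ for all $n\ge 0$. *)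

(* Defs.v *)
From HB Require Import structures.
From mathcomp Require Import all_boot all_order all_algebra.
From mathcomp Require Import boolp classical_sets reals topology normedtype sequences.

Set Implicit Arguments.
Unset Strict Implicit.
Unset Printing Implicit Defensive.

Import Order.TTheory GRing.Theory Num.Theory.
Import numFieldNormedType.Exports.

Local Open Scope classical_set_scope.
Local Open Scope ring_scope.

Record is_absval (R : realType) (K : fieldType) (v : K -> R) : Prop := IsAbsval {
  absval_ge0 : forall x, 0 <= v x;
  absval_eq0 : forall x, v x = 0 <-> x = 0;
  absvalM : forall x y, v (x * y) = v x * v y;
  absvalD : forall x y, v (x + y) <= Num.max (v x) (v y) }.

Definition converges (R : realType) (K : fieldType) (v : K -> R)
    (u : nat -> K) (l : K) : Prop :=
  (fun n => v (u n - l)) @ \oo --> (0 : R).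

(* Meaningful when [u] converges, in which case the limit is unique;
   the value is 0 otherwise. *)
Definition vlim (R : realType) (K : fieldType) (v : K -> R) (u : nat -> K) : K :=
  xget 0 [set l | converges v u l].

Definition vcomplete (R : realType) (K : fieldType) (v : K -> R) : Prop :=
  forall u : nat -> K,
    (forall e : R, 0 < e -> exists N : nat,
       forall m n : nat, (N <= m)%N -> (N <= n)%N -> v (u m - u n) < e) ->
    exists l, converges v u l.

Record is_completion (R : realType) (F K : fieldType) (vF : F -> R) (vK : K -> R)
    (iota : {rmorphism F -> K}) : Prop := IsCompletion {
  completion_absval : is_absval vK;
  completion_isometry : forall x, vK (iota x) = vF x;
  completion_dense : forall (x : K) (e : R), 0 < e -> exists y, vK (x - iota y) < e;
  completion_complete : vcomplete vK }.

Definition padic_abs (R : realType) (p : nat) (r : rat) : R :=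
  if r == 0 then 0
  else p%:R ^ ((logn p `|denq r|%N)%:Z - (logn p `|numq r|%N)%:Z).

(* C_p presented by its defining tower Q -> Q_p -> algebraic closure -> C_p,
   which determines it up to isometric isomorphism. *)
Record padic_complex (R : realType) (p : nat) := PadicComplex {
  Qp : fieldType;
  absQp : Qp -> R;
  Q_Qp : {rmorphism rat -> Qp};
  Qp_completion : is_completion (@padic_abs R p) absQp Q_Qp;
  Qpbar : closedFieldType;
  absQpbar : Qpbar -> R;
  Qp_Qpbar : {rmorphism Qp -> Qpbar};
  Qpbar_absval : is_absval absQpbar;
  Qpbar_extends : forall x, absQpbar (Qp_Qpbar x) = absQp x;
  Qpbar_algebraic : forall x, algebraicOver Qp_Qpbar x;
  Cp : fieldType;
  absCp : Cp -> R;
  Qpbar_Cp : {rmorphism Qpbar -> Cp};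
  Cp_completion : is_completion absQpbar absCp Qpbar_Cp }.

Section Fermionic.
Context (R : realType) (p : nat) (C : padic_complex R p).
Local Notation Qp := (Qp C).
Local Notation Cp := (Cp C).
Local Notation absQ := (@absQp R p C).
Local Notation absC := (@absCp R p C).

Definition Qp_Cp (a : Qp) : Cp := Qpbar_Cp C (Qp_Qpbar C a).

(* Functions on Z_p are represented by functions on Q_p of which only the
   values on this set are used. *)
Definition padic_int : set Qp := [set a | absQ a <= 1].

(* The difference quotient (F x - F y) / (x - y) has a limit as (x, y) tends to
   (a, a) off the diagonal, for each a in Z_p. *)
Definition uniformly_differentiable (F : Qp -> Cp) : Prop :=
  forall a, padic_int a -> exists d : Cp,
  forall e : R, 0 < e -> exists2 delta : R, 0 < delta &
  forall x y, padic_int x -> padic_int y -> x != y ->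
    absQ (x - a) < delta -> absQ (y - a) < delta ->
    absC ((F x - F y) / Qp_Cp (x - y) - d) < e.

Definition fermionic_int (F : Qp -> Cp) : Cp :=
  vlim absC (fun N => \sum_(0 <= a < p ^ N) F a%:R * (-1) ^+ a).

Fixpoint fermionic_mint (k : nat) : (k.-tuple Qp -> Cp) -> Cp :=
  match k return (k.-tuple Qp -> Cp) -> Cp with
  | 0 => fun F => F [tuple]
  | k'.+1 => fun F =>
      fermionic_int (fun a => fermionic_mint (fun v => F [tuple of a :: v]))
  end.

(* Every function integrated in [fermionic_mint] is uniformly differentiable
   on Z_p, so that the iterated integral is well defined. *)
Fixpoint fermionic_mintegrable (k : nat) : (k.-tuple Qp -> Cp) -> Prop :=
  match k return (k.-tuple Qp -> Cp) -> Prop with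
  | 0 => fun F => True
  | k'.+1 => fun F =>
      (forall a, padic_int a ->
         fermionic_mintegrable (fun v => F [tuple of a :: v])) /\
      uniformly_differentiable
        (fun a => fermionic_mint (fun v => F [tuple of a :: v]))
  end.

Definition padic_binomial (a : Qp) (n : nat) : Qp :=
  (\prod_(i < n) (a - i%:R)) / n`!%:R.

(* For |1 - w| < 1 and a in Z_p, the power w^a is the sum of the binomial series
   sum_n binom(a, n) (w - 1)^n. *)
Definition padic_pow (w : Cp) (a : Qp) : Cp :=
  vlim absC (fun N => \sum_(0 <= n < N) Qp_Cp (padic_binomial a n) * (w - 1) ^+ n).

End Fermionic.

(* Formal power series in t: [f n] is the coefficient of t^n. *)
Definition fps (A : Type) := nat -> A.

Definition fps_map (A B : Type) (phi : A -> B) (f : fps A) : fps B :=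
  fun n => phi (f n).

Definition fps_const (A : comUnitRingType) (c : A) : fps A :=
  fun n => if n == 0%N then c else 0.

Definition fps_add (A : comUnitRingType) (f g : fps A) : fps A :=
  fun n => f n + g n.

Definition fps_scale (A : comUnitRingType) (c : A) (f : fps A) : fps A :=
  fun n => c * f n.

Definition fps_mul (A : comUnitRingType) (f g : fps A) : fps A :=
  fun n => \sum_(i < n.+1) f i * g (n - i)%N.

Definition fps_pow (A : comUnitRingType) (f : fps A) (k : nat) : fps A :=
  iter k (fps_mul f) (fps_const 1).

(* The list of the first [n] coefficients of the inverse of [f]. *)
Fixpoint fps_inv_coefs (A : comUnitRingType) (f : fps A) (n : nat) : seq A :=
  if n is m.+1 then
    let s := fps_inv_coefs f m in
    rcons s ((f 0%N)^-1 * ((m == 0%N)%:R - \sum_(i < m) f (m - i)%N * s`_i))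
  else [::].

Definition fps_inv (A : comUnitRingType) (f : fps A) : fps A :=
  fun n => (fps_inv_coefs f n.+1)`_n.

Lemma size_fps_inv_coefs (A : comUnitRingType) (f : fps A) n :
  size (fps_inv_coefs f n) = n.
Proof. by elim: n => //= n IH; rewrite size_rcons IH. Qed.

Lemma nth_fps_inv_coefs (A : comUnitRingType) (f : fps A) n i :
  (i < n)%N -> (fps_inv_coefs f n)`_i = fps_inv f i.
Proof.
elim: n => // n IH; rewrite ltnS leq_eqVlt => /orP[/eqP-> //|lt_in].
by rewrite /= nth_rcons size_fps_inv_coefs lt_in IH.
Qed.

Lemma fps_invE (A : comUnitRingType) (f : fps A) n :
  fps_inv f n =
  (f 0%N)^-1 * ((n == 0%N)%:R - \sum_(i < n) f (n - i)%N * fps_inv f i).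
Proof.
rewrite {1}/fps_inv /= nth_rcons size_fps_inv_coefs ltnn eqxx.
by congr (_ * (_ - _)); apply: eq_bigr => i _; rewrite nth_fps_inv_coefs.
Qed.

Lemma fps_mulVr (A : comUnitRingType) (f : fps A) :
  f 0%N \is a GRing.unit -> fps_mul (fps_inv f) f = fps_const 1.
Proof.
move=> Uf; apply/funext => n; rewrite /fps_mul big_ord_recr /= subnn.
rewrite [fps_inv f n]fps_invE [_ * f 0%N]mulrC mulVKr //.
under eq_bigr do rewrite mulrC.
by rewrite addrC subrK /fps_const; case: eqP.
Qed.

(* e^{at}; for A = {poly K} and a = 'X this is e^{xt}. *)
Definition fps_exp (A : comUnitRingType) (a : A) : fps A :=
  fun n => a ^+ n / n`!%:R.

(* < f(t) | h(x) >: the coefficient of t^n / n! in f is n! [t^n] f. *)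
Definition umbral_pairing (K : fieldType) (f : fps K) (h : {poly K}) : K :=
  \sum_(n < size h) h`_n * (n`!%:R * f n).

(* (2 / (w e^t + 1))^k *)
Definition euler_gf (K : fieldType) (w : K) (k : nat) : fps K :=
  fps_pow (fps_mul (fps_const 2)
    (fps_inv (fps_add (fps_scale w (fps_exp 1)) (fps_const 1)))) k.

Definition weighted_euler_poly (K : fieldType) (w : K) (k n : nat) : {poly K} :=
  n`!%:R * fps_mul (fps_map polyC (euler_gf w k)) (fps_exp 'X) n.

Definition weighted_euler_number (K : fieldType) (w : K) (k n : nat) : K :=
  (weighted_euler_poly w k n).[0].

Section Integrands.
Context (R : realType) (p : nat) (C : padic_complex R p).
Local Notation Qp := (Qp C).
Local Notation Cp := (Cp C).

Definition tuple_sum (k : nat) (a : k.-tuple Qp) : Qp := \sum_(j < k) tnth a j.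

(* w^{a_1 + ... + a_k} e^{(a_1 + ... + a_k) t} *)
Definition exp_integrand (w : Cp) (k : nat) (a : k.-tuple Qp) : fps Cp :=
  fps_scale (padic_pow w (tuple_sum a)) (fps_exp (Qp_Cp (tuple_sum a))).

(* w^{a_1 + ... + a_k} h(a_1 + ... + a_k) *)
Definition poly_integrand (w : Cp) (h : {poly Cp}) (k : nat) (a : k.-tuple Qp) : Cp :=
  padic_pow w (tuple_sum a) * h.[Qp_Cp (tuple_sum a)].

(* The k-fold integral of a family of power series in t, coefficientwise. *)
Definition fermionic_mint_fps (k : nat) (Phi : k.-tuple Qp -> fps Cp) : fps Cp :=
  fun n => fermionic_mint (fun a => Phi a n).

End Integrands.

(* Main.v *)
From HB Require Import structures.
Require Import Defs.
From mathcomp Require Import all_boot all_order all_algebra.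
From mathcomp Require Import boolp classical_sets reals topology normedtype sequences.
From mathcomp Require Import ring.

(* Let D = d/dx and let T = G(D) be the differential operator with symbol
   G = 2 / (w e^t + 1), so that P = T h solves w P(x+1) + P(x) = 2 h(x). With
   F(a) = w^a P(a) this reads F(a+1) + F(a) = 2 w^a h(a), hence the alternating
   sums of w^(b+a) h(b+a) over 0 <= a < p^N telescope to (F(b) + F(b + p^N)) / 2
   (p is odd), which tends to F(b) by continuity. The k-fold integral is therefore
   w^b (T^k h)(b); at b = 0 this is (G(D)^k h)(0), the pairing of G^k with h.
   Strict differentiability of w^a at any point follows from additivity and from
   (w^a - 1) / a = sum_n binom(a-1, n) (w-1)^(n+1) / (n+1), a uniformly convergent
   series of polynomials in a. *)

Set Implicit Arguments.
Unset Strict Implicit.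
Unset Printing Implicit Defensive.

Import Order.TTheory GRing.Theory Num.Theory.
Import numFieldNormedType.Exports.
Local Open Scope classical_set_scope.
Local Open Scope ring_scope.

(** * Differential operators with constant coefficients *)

Lemma fps_mulC (A : comUnitRingType) (f g : fps A) : fps_mul f g = fps_mul g f.
Proof.
apply/funext => n; rewrite /fps_mul (reindex_inj rev_ord_inj) /=.
by apply: eq_bigr => i _; rewrite subSS subKn ?leq_ord // mulrC.
Qed.

(** The triangle i + j < N is cut into antidiagonals on one side and rows on the other; the
    induction adds the antidiagonal i + j = N. This is the reindexing behind the Cauchy product. *)
Lemma triangular_sum (V : nmodType) N (F : nat -> nat -> V) :
  \sum_(n < N) \sum_(i < n.+1) F i (n - i)%N
  = \sum_(i < N) \sum_(j < N - i) F i j.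
Proof.
elim: N => [|N IH]; first by rewrite !big_ord0.
rewrite big_ord_recr /= IH [RHS]big_ord_recr /= subSnn big_ord1.
rewrite [in LHS]big_ord_recr /= addrA -big_split subnn /=; congr (_ + _).
by apply: eq_bigr => i _; rewrite subSn 1?ltnW // big_ord_recr.
Qed.

Section DiffOperator.
Context (K : fieldType).
Implicit Types (f g : fps K) (h : {poly K}) (c w : K).

(* The operator f(D). *)
Definition dop f h : {poly K} := \sum_(n < size h) f n *: h^`(n).

Lemma dopE N f h : (size h <= N)%N -> dop f h = \sum_(n < N) f n *: h^`(n).
Proof.
move=> hN; rewrite /dop (big_ord_widen N (fun n => f n *: h^`(n))) //.
rewrite big_mkcond; apply: eq_bigr => n _; case: ltnP => // hn.
by rewrite derivn_poly0 // scaler0.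
Qed.

Lemma size_derivn n h : (size h^`(n) <= size h)%N.
Proof.
apply/leq_sizeP => j hj; rewrite coef_derivn nth_default ?mul0rn //.
exact: leq_trans hj (leq_addl _ _).
Qed.

Lemma size_dop f h : (size (dop f h) <= size h)%N.
Proof.
apply: (leq_trans (size_sum _ _ _)); apply/bigmax_leqP => n _.
exact: leq_trans (size_scale_leq _ _) (size_derivn _ _).
Qed.

Lemma dopZ f c h : dop f (c *: h) = c *: dop f h.
Proof.
rewrite (dopE _ (size_scale_leq c h)) /dop scaler_sumr.
by apply: eq_bigr => n _; rewrite derivnZ !scalerA mulrC.
Qed.

Lemma dop_add f g h : dop (fps_add f g) h = dop f h + dop g h.
Proof. by rewrite /dop -big_split; apply: eq_bigr => n _; rewrite scalerDl. Qed.

Lemma dop_scale c f h : dop (fps_scale c f) h = c *: dop f h.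
Proof. by rewrite /dop scaler_sumr; apply: eq_bigr => n _; rewrite scalerA. Qed.

Lemma dop_const c h : dop (fps_const c) h = c *: h.
Proof.
rewrite (@dopE (size h).+1) // big_ord_recl big1 ?addr0 // => n _.
by rewrite scale0r.
Qed.

(** The Cauchy product matches D^i D^j = D^(i+j), so powers of a series act as iterates of one
    operator. *)
Lemma dop_mul f g h : dop (fps_mul f g) h = dop f (dop g h).
Proof.
rewrite (dopE f (size_dop g h)) [LHS]/dop; set N := size h.
under eq_bigr => n _ do rewrite /fps_mul scaler_suml.
(* The order n is split as i + (n - i), so that the summand depends on i and j = n - i alone. *)
have E (n : 'I_N) : \sum_(i < n.+1) (f i * g (n - i)%N) *: h^`(n)
    = \sum_(i < n.+1) (f i * g (n - i)%N) *: h^`(i + (n - i)).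
  by apply: eq_bigr => i _; rewrite subnKC // leq_ord.
under eq_bigr => n _ do rewrite E.
rewrite (triangular_sum _ (fun i j => (f i * g j) *: h^`(i + j))).
apply: eq_bigr => i _; rewrite /dop linear_sum scaler_sumr -/N.
(* The row j < N - i is extended to j < N; the added derivatives have order at least the size of [h]
   and vanish. *)
rewrite (big_ord_widen N (fun j => (f i * g j) *: h^`(i + j))) ?leq_subr //.
rewrite big_mkcond; apply: eq_bigr => j _ /=.
rewrite derivnZ scalerA -[_^`(i)]/(iter i _ (iter j _ _)) -iterD.
rewrite -[iter _ _ _]/(h^`(i + j)).
by case: ltnP => //; rewrite leq_subLR => Nij; rewrite derivn_poly0 ?scaler0.
Qed.

Lemma umbral_pairingE f h : umbral_pairing f h = (dop f h).[0].
Proof.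
rewrite /umbral_pairing /dop horner_sum; apply: eq_bigr => n _.
by rewrite hornerZ horner_coef0 coef_derivn addn0 ffactnn mulr_natl !mulrnAr mulrC.
Qed.

Lemma fact_neq0 n : [pchar K] =i pred0 -> n`!%:R != 0 :> K.
Proof. by move=> /pcharf0P ->; rewrite -lt0n fact_gt0. Qed.

(** Taylor's formula makes e^D the shift by 1; characteristic 0 turns the divided derivatives into
    h^(n) / n!. *)
Lemma horner_dop_exp h x : [pchar K] =i pred0 -> (dop (fps_exp 1) h).[x] = h.[x + 1].
Proof.
move=> K0; rewrite nderiv_taylor ?horner_sum; last exact: mulrC.
apply: eq_bigr => n _; rewrite /fps_exp !expr1n mulr1 hornerZ nderivn_def hornerMn.
by rewrite mulrnAr -mulrnAl -[_ *+ _]mulr_natr divfK ?mul1r // fact_neq0.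
Qed.

(** The symbol G = 2 / (w e^t + 1); [euler_gf w k] is its k-th power. *)
Definition euler_factor (w : K) : fps K :=
  fps_mul (fps_const 2) (fps_inv (fps_add (fps_scale w (fps_exp 1)) (fps_const 1))).

Lemma dop_euler_gfS w k h :
  dop (euler_gf w k.+1) h = dop (euler_factor w) (dop (euler_gf w k) h).
Proof. by rewrite -dop_mul. Qed.

Lemma dop_euler_gf0 w h : dop (euler_gf w 0) h = h.
Proof. by rewrite dop_const scale1r. Qed.

(** The left side is (w e^D + 1) applied to G(D) h, and the two symbols multiply to 2. The condition
    on [w] makes the constant coefficient of w e^t + 1 invertible. *)
Lemma euler_factor_eq w h x : [pchar K] =i pred0 -> w + 1 != 0 ->
  w * (dop (euler_factor w) h).[x + 1] + (dop (euler_factor w) h).[x] = 2 * h.[x].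
Proof.
move=> K0 w1; pose E := fps_add (fps_scale w (fps_exp 1)) (fps_const 1).
set P := dop _ h; have -> : w * P.[x + 1] + P.[x] = (dop E P).[x].
  by rewrite dop_add dop_scale dop_const scale1r hornerD hornerZ horner_dop_exp.
rewrite /P /euler_factor dop_mul dop_const dopZ -dop_mul -/E fps_mulC fps_mulVr.
  by rewrite dop_const scale1r hornerZ.
by rewrite unitfE /E /fps_add /fps_scale /fps_exp /fps_const expr0 fact0 divr1 mulr1.
Qed.

Lemma weighted_euler_numberE w k n :
  weighted_euler_number w k n = n`!%:R * euler_gf w k n.
Proof.
rewrite /weighted_euler_number /weighted_euler_poly hornerM.
rewrite -polyC_natr hornerC; congr (_ * _).
rewrite /fps_mul horner_sum big_ord_recr big1 /= => [|i _].
  by rewrite add0r subnn hornerM hornerC /fps_exp expr0 fact0 divr1 hornerC mulr1.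
by rewrite !hornerM hornerXn expr0n subn_eq0 leqNgt ltn_ord mul0r mulr0.
Qed.

Lemma umbral_pairingXn (f : fps K) n : umbral_pairing f 'X^n = n`!%:R * f n.
Proof.
rewrite /umbral_pairing size_polyXn big_ord_recr big1 /= => [|i _].
  by rewrite coefXn eqxx mul1r add0r.
by rewrite coefXn ltn_eqF ?mul0r.
Qed.

End DiffOperator.

(** * Limits for an ultrametric absolute value *)

Section AbsoluteValue.
Context (R : realType) (K : fieldType) (v : K -> R) (vK : is_absval v).
Implicit Types (x y : K) (e : R).

Lemma absv0 : v 0 = 0. Proof. exact/(absval_eq0 vK). Qed.

Lemma absv_gt0 x : (0 < v x) = (x != 0).
Proof.
rewrite lt_def (absval_ge0 vK) andbT; congr (~~ _).
by apply/eqP/eqP => /(absval_eq0 vK).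
Qed.

Lemma absv1 : v 1 = 1.
Proof.
have v1 : v 1 != 0 by rewrite gt_eqF // absv_gt0 oner_neq0.
by apply: (mulfI v1); rewrite -(absvalM vK) !mulr1.
Qed.

Lemma absvN x : v (- x) = v x.
Proof.
have : v (-1) ^+ 2 == 1 by rewrite expr2 -(absvalM vK) mulrNN mulr1 absv1.
rewrite sqrf_eq1 => /orP[] /eqP vN1; first by rewrite -mulN1r (absvalM vK) vN1 mul1r.
by have := absval_ge0 vK (-1); rewrite vN1 oppr_ge0 ler10.
Qed.

Lemma absvB_sym x y : v (x - y) = v (y - x).
Proof. by rewrite -absvN opprB. Qed.

Lemma absvX x n : v (x ^+ n) = v x ^+ n.
Proof. by elim: n => [|n IH]; rewrite ?absv1 // !exprS (absvalM vK) IH. Qed.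

Lemma absvV x : v x^-1 = (v x)^-1.
Proof.
have [->|x0] := eqVneq x 0; first by rewrite invr0 absv0 invr0.
have vx : v x != 0 by rewrite gt_eqF // absv_gt0.
by apply: (mulfI vx); rewrite -(absvalM vK) !divff // absv1.
Qed.

Lemma absvD_le x y e : v x <= e -> v y <= e -> v (x + y) <= e.
Proof. by move=> xe ye; rewrite (le_trans (absvalD vK _ _)) // ge_max xe. Qed.

Lemma absvD_lt x y e : v x < e -> v y < e -> v (x + y) < e.
Proof. by move=> xe ye; rewrite (le_lt_trans (absvalD vK _ _)) // gt_max xe. Qed.

Lemma absv_sum_le (I : Type) (r : seq I) (P : pred I) (F : I -> K) e :
  0 <= e -> (forall i, P i -> v (F i) <= e) -> v (\sum_(i <- r | P i) F i) <= e.
Proof.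
move=> e0 Fe; elim/big_ind: _ => //; first by rewrite absv0.
by move=> x y; apply: absvD_le.
Qed.

Lemma absv_nat_le1 n : v n%:R <= 1.
Proof. by rewrite -[n]subn0 -sumr_const_nat absv_sum_le ?ler01 ?absv1. Qed.

Lemma absv_int_le1 (m : int) : v m%:~R <= 1.
Proof. by case: m => n; rewrite ?NegzE ?mulrNz ?absvN absv_nat_le1. Qed.

Section Limit.
Context (T : Type) (F : set_system T).

(** An arbitrary filter lets one calculus of limits serve sequences, points of Z_p and difference
    quotients. *)
Definition vcvg (u : T -> K) (l : K) : Prop :=
  forall e : R, 0 < e -> F [set t | v (u t - l) < e].

Context {FF : Filter F}.
Implicit Types (u s : T -> K) (l m : K).

Lemma vcvg_cst l : vcvg (fun=> l) l.
Proof.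
by move=> e e0; apply: filterS filterT => t _ /=; rewrite subrr absv0.
Qed.

Lemma vcvgD u s l m : vcvg u l -> vcvg s m -> vcvg (fun t => u t + s t) (l + m).
Proof.
move=> ul sm e e0; apply: filterS (filterI (ul e e0) (sm e e0)) => t [/= ut st].
by rewrite opprD addrACA absvD_lt.
Qed.

Lemma vcvgM u s l m : vcvg u l -> vcvg s m -> vcvg (fun t => u t * s t) (l * m).
Proof.
(* [M] bounds [l] and [m], and also [s t] once it is within 1 of [m]; by the ultrametric inequality
   the two error terms need not share [e]. *)
move=> ul sm e e0; pose M := Num.max 1 (Num.max (v l) (v m)).
have M1 : 1 <= M by rewrite le_max lexx.
have M0 : 0 < M by exact: lt_le_trans M1.
have lM : v l <= M by rewrite !le_max lexx orbT.
have mM : v m <= M by rewrite !le_max lexx !orbT.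
have e1 : 0 < Num.min 1 (e / M) by rewrite lt_min ltr01 divr_gt0.
apply: filterS (filterI (ul _ e1) (sm _ e1)) => t [] /=.
rewrite !lt_min => /andP[_ ut] /andP[st1 st].
have -> : u t * s t - l * m = (u t - l) * s t + l * (s t - m).
  by rewrite mulrBl mulrBr addrA subrK.
have stM : v (s t) <= M.
  by rewrite -[s t](subrK m) absvD_le // (le_trans _ M1) // ltW.
apply: absvD_lt; rewrite (absvalM vK).
  apply: le_lt_trans (ler_wpM2l (absval_ge0 vK _) stM) _.
  by rewrite -ltr_pdivlMr.
apply: le_lt_trans (ler_wpM2r (absval_ge0 vK _) lM) _.
by rewrite -ltr_pdivlMl // mulrC.
Qed.

Lemma vcvgMl c u l : vcvg u l -> vcvg (fun t => c * u t) (c * l).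
Proof. exact/vcvgM/vcvg_cst. Qed.

Lemma vcvgB u s l m : vcvg u l -> vcvg s m -> vcvg (fun t => u t - s t) (l - m).
Proof.
move=> ul sm; rewrite -mulN1r; under [X in vcvg X]funext do rewrite -mulN1r.
exact/vcvgD/vcvgMl.
Qed.

Lemma vcvg_near u s l : F [set t | u t = s t] -> vcvg u l -> vcvg s l.
Proof.
by move=> us ul e e0; apply: filterS (filterI us (ul e e0)) => t [/= ->].
Qed.

Lemma vcvg_ext u s l : u =1 s -> vcvg u l -> vcvg s l.
Proof. by move=> us; apply: vcvg_near; apply: filterS filterT => t _ /=. Qed.

End Limit.

Lemma vcvg_unique (T : Type) (F : set_system T) {FF : ProperFilter F}
  (u : T -> K) (l m : K) : vcvg F u l -> vcvg F u m -> l = m.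
Proof.
move=> ul um; apply/eqP; rewrite -subr_eq0 -[_ == _]negbK -absv_gt0; apply/negP => e0.
have [t [/= tl tm]] := filter_ex (filterI (ul _ e0) (um _ e0)).
rewrite absvB_sym in tl; have := absvD_lt tl tm.
by rewrite addrA subrK ltxx.
Qed.

Lemma convergesE (u : nat -> K) (l : K) : converges v u l = vcvg \oo u l.
Proof.
apply/propext; rewrite /converges /vcvg; split => [/cvgr0Pnorm_lt H e e0|H].
  by apply: filterS (H e e0) => n /=; rewrite ger0_norm ?(absval_ge0 vK).
apply/cvgr0Pnorm_lt => e e0.
by apply: filterS (H e e0) => n /=; rewrite ger0_norm ?(absval_ge0 vK).
Qed.

(** Closed balls are closed: otherwise a value [u t] in the ball, closer to [l] than [v (l - a)],
    would force [v (l - a) < v (l - a)]. *)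
Lemma vcvg_le (T : Type) (F : set_system T) {FF : ProperFilter F}
  (u : T -> K) (l a : K) e :
  vcvg F u l -> F [set t | v (u t - a) <= e] -> v (l - a) <= e.
Proof.
move=> ul ua; rewrite leNgt; apply/negP => ela.
have e0 : 0 < v (l - a).
  have [t /= ut] := filter_ex ua.
  exact: le_lt_trans (le_trans (absval_ge0 vK _) ut) ela.
have [t [/= tl ta]] := filter_ex (filterI (ul _ e0) ua).
rewrite absvB_sym in tl; have := absvD_lt tl (le_lt_trans ta ela).
by rewrite addrA subrK ltxx.
Qed.

Lemma vlim_eq (u : nat -> K) (l : K) : vcvg \oo u l -> vlim v u = l.
Proof.
move=> ul; apply: xget_unique => [|m]; rewrite /= convergesE // => um.
exact: vcvg_unique um ul.
Qed.

(** * Series over a complete ultrametric field *)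

Section Series.
Context (Kc : vcomplete v).
Implicit Types (c : nat -> K) (M : nat -> R).

Definition psum c (N : nat) : K := \sum_(0 <= n < N) c n.

Lemma psum_tail_le c e N m n : (forall i, (N <= i)%N -> v (c i) <= e) ->
  (N <= m)%N -> (m <= n)%N -> 0 <= e -> v (psum c n - psum c m) <= e.
Proof.
move=> ce Nm mn e0; rewrite /psum (big_cat_nat (leq0n m) mn) /= addrAC subrr add0r.
rewrite big_nat_cond; apply: absv_sum_le => // i /andP[/andP[mi _] _].
exact/ce/(leq_trans Nm).
Qed.

Lemma cvg0_small M e : M @ \oo --> (0 : R) -> 0 < e ->
  exists N, forall i, (N <= i)%N -> M i < e.
Proof.
move=> /cvgr0Pnorm_lt M0 /M0[N _ NM]; exists N => i Ni.
exact: le_lt_trans (ler_norm _) (NM i Ni).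
Qed.

(** A block of consecutive terms is no larger than its largest term, so terms tending to 0 already
    make the partial sums Cauchy. *)
Lemma vseries_cvg c M : (forall n, v (c n) <= M n) -> M @ \oo --> (0 : R) ->
  vcvg \oo (psum c) (vlim v (psum c)).
Proof.
move=> cM M0; suff [l cl] : exists l, converges v (psum c) l.
  by rewrite convergesE in cl; rewrite (vlim_eq cl).
apply: Kc => e e0; have [N NM] := cvg0_small M0 (divr_gt0 e0 (ltr0n _ 2)).
have ce i : (N <= i)%N -> v (c i) <= e / 2.
  by move=> Ni; apply/(le_trans (cM i))/ltW/NM.
have e2 : 0 <= e / 2 by rewrite ltW // divr_gt0.
have e2e : e / 2 < e by rewrite ltr_pdivrMr // ltr_pMr // ltr1n.
exists N => m n Nm Nn; apply: le_lt_trans e2e.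
case/orP: (leq_total m n) => [mn|nm]; last exact: psum_tail_le ce _ _ _.
by rewrite absvB_sym; apply: psum_tail_le ce _ _ _.
Qed.

Lemma vcvg_psum (T : Type) (F : set_system T) {FF : Filter F}
  (c : T -> nat -> K) (l : nat -> K) N :
  (forall n, vcvg F (fun t => c t n) (l n)) ->
  vcvg F (fun t => psum (c t) N) (psum l N).
Proof.
move=> cl; elim: N => [|N IH].
  rewrite /psum big_geq //; apply: vcvg_ext (vcvg_cst 0) => t.
  by rewrite big_geq.
rewrite /psum big_nat_recr //=; apply: vcvg_ext (vcvgD IH (cl N)) => t.
by rewrite /psum big_nat_recr.
Qed.

(** The majorant [M] makes the tails small uniformly on [D]; finite partial sums converge termwise,
    and the ultrametric inequality joins the three differences. *)
Lemma vcvg_vseries (T : Type) (F : set_system T) {FF : Filter F}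
  (c : T -> nat -> K) (l : nat -> K) M (D : set T) :
  F D -> (forall t n, D t -> v (c t n) <= M n) -> (forall n, v (l n) <= M n) ->
  M @ \oo --> (0 : R) -> (forall n, vcvg F (fun t => c t n) (l n)) ->
  vcvg F (fun t => vlim v (psum (c t))) (vlim v (psum l)).
Proof.
move=> FD cM lM M0 cl e e0.
have [N NM] := cvg0_small M0 (divr_gt0 e0 (ltr0n _ 2)).
have tail (d : nat -> K) : (forall n, v (d n) <= M n) -> v (vlim v (psum d) - psum d N) < e.
  move=> dM; have e2 : 0 <= e / 2 by rewrite ltW // divr_gt0.
  have e2e : e / 2 < e by rewrite ltr_pdivrMr // ltr_pMr // ltr1n.
  apply: le_lt_trans e2e; apply: (vcvg_le (vseries_cvg dM M0)).
  exists N => // n /= Nn; apply: (@psum_tail_le d _ N) => // i Ni.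
  exact/(le_trans (dM i))/ltW/NM.
apply: filterS (filterI FD (vcvg_psum N cl e0)) => t [/= Dt ct].
have h1 := tail _ (fun n => cM t n Dt); have h2 := tail _ lM.
rewrite absvB_sym in h2; have := absvD_lt h1 (absvD_lt ct h2).
by rewrite !subrKA.
Qed.

End Series.
End AbsoluteValue.

(** With q = r^2, the factor n + 1 is absorbed by r^n and a geometric sequence is left. This is the
    majorant for a series with denominators n + 1. *)
Lemma cvg_nat_expr (R : realType) (q : R) : 0 <= q -> q < 1 ->
  (fun n => n.+1%:R * q ^+ n.+1) @ \oo --> (0 : R).
Proof.
move=> q0 q1; pose r := Num.sqrt q.
have r0 : 0 <= r := sqrtr_ge0 q.
have r1 : r < 1 by rewrite -sqrtr1 ltr_sqrt.
(* As r <= 1, (n + 1) r^n is at most 1 + r + ... + r^n, which is at most 1 / (1 - r). *)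
have nr n : n.+1%:R * r ^+ n <= (1 - r)^-1.
  rewrite -[leRHS]mul1r ler_pdivlMr ?subr_gt0 //.
  apply: (@le_trans _ _ (1 - r ^+ n.+1)); last by rewrite gerBl exprn_ge0.
  have := subrXX 1 r n.+1; rewrite expr1n => ->; rewrite mulrC.
  apply: ler_wpM2l; first by rewrite subr_ge0 ltW.
  rewrite mulr_natl -[n.+1 in leLHS]card_ord -sumr_const; apply: ler_sum => i _.
  by rewrite expr1n mul1r ler_wiXn2l // ?ltW // -ltnS.
apply: (@squeeze_cvgr _ _ _ _ (fun=> 0) (geometric ((1 - r)^-1) r)).
- near=> n; rewrite /= mulr_ge0 ?exprn_ge0 //=.
  have -> : q ^+ n.+1 = r ^+ n * r ^+ n.+2.
    by rewrite -exprD !addnS addnn -doubleS -mul2n exprM sqr_sqrtr.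
  rewrite mulrA; apply: ler_pM; rewrite ?exprn_ge0 //; first by rewrite mulr_ge0 ?exprn_ge0.
  by apply: ler_wiXn2l; rewrite ?(ltW r1) // !leqW.
- exact: cvg_cst.
- by apply: cvg_geometric; rewrite ger0_norm.
Unshelve. all: by end_near. Qed.

(** * p-adic numbers *)

HB.instance Definition _ (R : realType) (p : nat) (C : padic_complex R p) :=
  GRing.RMorphism.copy (@Qp_Cp R p C) (Qpbar_Cp C \o Qp_Qpbar C).

Section PadicComplex.
Context (R : realType) (p : nat) (p_prime : prime p) (C : padic_complex R p).
Local Notation Qp := (Qp C).
Local Notation Cp := (Cp C).
Local Notation absQ := (@absQp R p C).
Local Notation absC := (@absCp R p C).
Local Notation Zp := (@padic_int R p C).
Local Notation i_ := (@Qp_Cp R p C).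
Implicit Types (a b x y : Qp) (e : R) (F G : Qp -> Cp).

Let vQ : is_absval absQ := completion_absval (Qp_completion C).
Let vC : is_absval absC := completion_absval (Cp_completion C).
Let cC : vcomplete absC := completion_complete (Cp_completion C).

Lemma absCp_Qp_Cp a : absC (i_ a) = absQ a.
Proof.
by rewrite /Qp_Cp (completion_isometry (Cp_completion C)) Qpbar_extends.
Qed.

Lemma absQp_rat (r : rat) : absQ (Q_Qp C r) = padic_abs R p r.
Proof. exact: (completion_isometry (Qp_completion C)). Qed.

Lemma absQp_nat n : (0 < n)%N -> absQ n%:R = p%:R ^- logn p n.
Proof.
move=> n0; rewrite -(rmorph_nat (Q_Qp C)) absQp_rat /padic_abs.
rewrite pnatr_eq0 eqn0Ngt n0 /= -[n%:R]/(n%:Z%:~R).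
by rewrite denq_int numq_int logn1 sub0r !absz_nat -exprnN.
Qed.

Lemma pchar_Qp : [pchar Qp] =i pred0.
Proof.
apply/pcharf0P => n; rewrite -(rmorph_nat (Q_Qp C)) fmorph_eq0 pnatr_eq0.
by [].
Qed.

Lemma pchar_Cp : [pchar Cp] =i pred0.
Proof.
apply/pcharf0P => n; rewrite -(rmorph_nat i_) fmorph_eq0.
by move/pcharf0P: pchar_Qp => ->.
Qed.

Lemma p_gt1R : 1 < p%:R :> R. Proof. by rewrite ltr1n prime_gt1. Qed.

(** The p-part of n is at most n; this bounds the p-adic size of 1 / n by n. *)
Lemma absQp_nat_ge n : (0 < n)%N -> n%:R^-1 <= absQ n%:R.
Proof.
move=> n0; have p0 : 0 < p%:R :> R := lt_trans ltr01 p_gt1R.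
rewrite absQp_nat // lef_pV2 ?posrE ?ltr0n ?exprn_gt0 // -natrX ler_nat.
by rewrite dvdn_leq // pfactor_dvdnn.
Qed.

Lemma absQp_expp n : absQ (p ^ n)%:R = p%:R ^- n.
Proof. by rewrite absQp_nat ?expn_gt0 ?prime_gt0 // pfactorK. Qed.

Lemma absCp_two : odd p -> absC 2 = 1.
Proof.
move=> p_odd; rewrite -(rmorph_nat i_) absCp_Qp_Cp absQp_nat //.
rewrite lognE p_prime /= dvdn_prime2 //.
by case: eqP p_odd => [->|_ _] //; rewrite expr0 invr1.
Qed.

Lemma expp_small e : 0 < e -> exists n, p%:R ^- n < e.
Proof.
move=> e0; have p0 : 0 < p%:R :> R := lt_trans ltr01 p_gt1R.
have : geometric 1 (p%:R^-1 : R) @ \oo --> (0 : R).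
  apply: cvg_geometric; rewrite ger0_norm ?invr_ge0 1?ltW //.
  by rewrite invf_lt1 ?p_gt1R.
move/cvg0_small => /(_ _ e0)[n /(_ n (leqnn n))]; rewrite /= mul1r exprVn.
by exists n.
Qed.

Lemma padic_intD a b : Zp a -> Zp b -> Zp (a + b).
Proof. exact: absvD_le. Qed.

Lemma padic_intB a b : Zp a -> Zp b -> Zp (a - b).
Proof. by move=> Za Zb; apply: padic_intD => //; rewrite /padic_int /= absvN. Qed.

Lemma padic_int_nat n : Zp n%:R. Proof. exact: absv_nat_le1. Qed.

(** A rational close to [a] is p-integral, so its denominator is invertible modulo p^N and the
    rational is congruent to a natural number modulo p^N. *)
Lemma padic_int_dense a e : Zp a -> 0 < e -> exists m : nat, absQ (m%:R - a) < e.
Proof.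
move=> Za e0; have e1 : 0 < Num.min e 1 by rewrite lt_min e0 ltr01.
have [r] := completion_dense (Qp_completion C) a e1.
rewrite lt_min => /andP[are ar1].
have {ar1} r1 : absQ (Q_Qp C r) <= 1.
  rewrite -[Q_Qp C r](subrK a) absvD_le // absvB_sym //; exact: ltW.
pose d := denq r; have d0 : d != 0 := denq_neq0 r.
(* If p divided the denominator it would not divide the numerator, and the absolute value of [r]
   would exceed 1. *)
have pd : ~~ (p %| `|d|)%N.
  apply/negP => pd; move: r1; rewrite absQp_rat /padic_abs.
  have r0 : r != 0 by apply: contraTneq pd => r0; rewrite /d r0 dvdn1 gtn_eqF ?prime_gt1.
  rewrite (negbTE r0).
  have -> : logn p `|numq r| = 0%N.
    apply/eqP; rewrite -leqn0 leqNgt logn_gt0 mem_primes.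
    apply/negP => /and3P[_ _ pn].
    have := dvdn_gcd p `|numq r| `|d|; rewrite pn pd (eqP (coprime_num_den r)).
    by rewrite dvdn1 gtn_eqF ?prime_gt1.
  rewrite subr0 leNgt => /negP; apply; rewrite -exprnP exprn_egt1 ?p_gt1R //.
  by rewrite -lt0n logn_gt0 mem_primes p_prime pd absz_gt0 d0.
have vd : absQ d%:~R = 1.
  rewrite -[d]gez0_abs ?denq_ge0 // absQp_nat ?absz_gt0 //.
  by rewrite lognE p_prime absz_gt0 d0 (negbTE pd) expr0 invr1.
have [N pN] := expp_small e0.
have [m /dvdzP[c dm]] : exists m : nat, ((p ^ N)%:Z %| numq r - m%:Z * d)%Z.
  have [u [w uw]] := Bezoutz d (p ^ N)%:Z.
  have dp1 : gcdz d (p ^ N)%:Z = 1.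
    by apply/eqP; rewrite -/(coprimez _ _) coprimezE coprime_sym coprimeXl ?prime_coprime.
  have pN0 : (p ^ N)%:Z != 0 by rewrite eqz_nat -lt0n expn_gt0 prime_gt0.
  (* The Bezout coefficient [u] inverts [d] modulo p^N; the residue of [numq r * u] is nonnegative,
     hence a natural number. *)
  exists `|((numq r * u) %% (p ^ N)%:Z)%Z|%N; rewrite gez0_abs ?modz_ge0 //.
  apply/dvdzP; exists (numq r * w + ((numq r * u) %/ (p ^ N)%:Z)%Z * d).
  rewrite [X in _ - X * d](_ : _ = numq r * u - ((numq r * u) %/ (p ^ N)%:Z)%Z * (p ^ N)%:Z).
    rewrite -[X in X - _]mulr1 -dp1 -uw; ring.
  by rewrite {2}(divz_eq (numq r * u) (p ^ N)%:Z) addrC addKr.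
exists m.
have -> : m%:R - a = (Q_Qp C r - a) - (Q_Qp C r - m%:R) by rewrite opprB [RHS]addrC subrKA.
apply: (absvD_lt vQ); first by rewrite (absvB_sym vQ).
rewrite (absvN vQ); apply: le_lt_trans pN.
have d0' : d%:~R != 0 :> Qp by rewrite -(absv_gt0 vQ) vd ltr01.
have -> : Q_Qp C r - m%:R = (c * (p ^ N)%:Z)%:~R / d%:~R.
  rewrite -dm -{1}[r]divq_num_den fmorph_div !rmorph_int rmorphB rmorphM /=.
  by rewrite mulrBl mulfK.
rewrite (absvalM vQ) absvV // vd invr1 mulr1 rmorphM (absvalM vQ) -absQp_expp.
by rewrite ler_piMl ?(absval_ge0 vQ) ?absv_int_le1.
Qed.

(** * Continuity and strict differentiability on Z_p *)

Definition zp_nbhs a : set_system Qp := fun A =>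
  exists2 d : R, 0 < d & forall x, Zp x -> absQ (x - a) < d -> A x.

(** Off-diagonal pairs near (a, a): the filter along which difference quotients are required to
    converge. *)
Definition zp_nbhs2 a : set_system (Qp * Qp) := fun A =>
  exists2 d : R, 0 < d & forall x y, Zp x -> Zp y -> x != y ->
    absQ (x - a) < d -> absQ (y - a) < d -> A (x, y).

(** The trace on the naturals of the neighbourhoods of [a]; for [a] in Z_p it is a proper filter
    because the naturals are dense there. *)
Definition nat_nbhs a : set_system nat := fun A =>
  exists2 d : R, 0 < d & forall m, absQ (m%:R - a) < d -> A m.

Global Instance zp_nbhs_filter a : Filter (zp_nbhs a).
Proof.
split; first by exists 1.
- move=> A B [d d0 dA] [d' d'0 dB]; exists (Num.min d d'); first by rewrite lt_min d0.
  by move=> x Zx; rewrite lt_min => /andP[xd xd']; split; [apply: dA|apply: dB].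
- by move=> A B AB [d d0 dA]; exists d => // x Zx xd; apply/AB/dA.
Qed.

Global Instance zp_nbhs2_filter a : Filter (zp_nbhs2 a).
Proof.
split; first by exists 1.
- move=> A B [d d0 dA] [d' d'0 dB]; exists (Num.min d d'); first by rewrite lt_min d0.
  move=> x y Zx Zy xy; rewrite !lt_min => /andP[xd xd'] /andP[yd yd'].
  by split; [apply: dA|apply: dB].
- by move=> A B AB [d d0 dA]; exists d => // x y Zx Zy xy xd yd; apply/AB/dA.
Qed.

Lemma nat_nbhs_proper a : Zp a -> ProperFilter (nat_nbhs a).
Proof.
move=> Za; split.
  by move=> [d d0 dA]; have [m /dA] := padic_int_dense Za d0.
split; first by exists 1.
- move=> A B [d d0 dA] [d' d'0 dB]; exists (Num.min d d'); first by rewrite lt_min d0.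
  by move=> x; rewrite lt_min => /andP[xd xd']; split; [apply: dA|apply: dB].
- by move=> A B AB [d d0 dA]; exists d => // x xd; apply/AB/dA.
Qed.

Lemma vcvg_comp (S T : Type) (F : set_system S) (G : set_system T)
    (f : S -> T) (u : T -> Cp) l :
  (forall A, G A -> F (f @^-1` A)) -> vcvg absC G u l -> vcvg absC F (u \o f) l.
Proof. by move=> fFG ul e e0; apply: fFG (ul e e0). Qed.

Definition zp_continuous F := forall a, Zp a -> vcvg absC (zp_nbhs a) F (F a).

Lemma zp_continuous_nat F a : zp_continuous F -> Zp a ->
  vcvg absC (nat_nbhs a) (fun m => F m%:R) (F a).
Proof.
move=> cF Za; apply: vcvg_comp (cF a Za) => A [d d0 dA]; exists d => // m md.
exact: dA (padic_int_nat _) md.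
Qed.

(** Limits along the naturals are unique, so an identity between continuous functions need only be
    checked there. *)
Lemma zp_continuous_eq F G a : zp_continuous F -> zp_continuous G ->
  (forall m : nat, F m%:R = G m%:R) -> Zp a -> F a = G a.
Proof.
move=> cF cG FG Za; have nF := nat_nbhs_proper Za.
apply: (vcvg_unique vC (zp_continuous_nat cF Za)).
exact: vcvg_ext (fun m => esym (FG m)) (zp_continuous_nat cG Za).
Qed.

Lemma zp_continuous_le F a e : zp_continuous F ->
  (forall m : nat, absC (F m%:R) <= e) -> Zp a -> absC (F a) <= e.
Proof.
move=> cF Fe Za; have nF := nat_nbhs_proper Za.
rewrite -[F a]subr0; apply: (vcvg_le vC (zp_continuous_nat cF Za)).
by apply: filterS filterT => m _ /=; rewrite subr0.
Qed.

Lemma zp_continuous_cst (c : Cp) : zp_continuous (fun=> c).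
Proof. by move=> a _; apply: vcvg_cst. Qed.

Lemma zp_continuous_id : zp_continuous i_.
Proof.
move=> a _ e e0; exists e => // x _ xe /=.
by rewrite -rmorphB absCp_Qp_Cp.
Qed.

Lemma zp_continuousD F G : zp_continuous F -> zp_continuous G ->
  zp_continuous (fun x => F x + G x).
Proof. by move=> cF cG a Za; apply: vcvgD (cF a Za) (cG a Za). Qed.

Lemma zp_continuousM F G : zp_continuous F -> zp_continuous G ->
  zp_continuous (fun x => F x * G x).
Proof. by move=> cF cG a Za; apply: vcvgM (cF a Za) (cG a Za). Qed.

Lemma zp_continuous_shift F b : Zp b -> zp_continuous F ->
  zp_continuous (fun x => F (b + x)).
Proof.
move=> Zb cF a Za; apply: vcvg_comp (cF _ (padic_intD Zb Za)) => A [d d0 dA].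
exists d => // x Zx xd; apply: dA; first exact: padic_intD.
by rewrite opprD addrACA subrr add0r.
Qed.

Lemma zp_continuous_horner (h : {poly Cp}) : zp_continuous (fun x => h.[i_ x]).
Proof.
elim/poly_ind: h => [|h c IH] a Za.
  by rewrite horner0; apply: vcvg_ext (zp_continuous_cst 0 Za) => x; rewrite horner0.
rewrite hornerMXaddC.
apply: vcvg_ext (zp_continuousD (zp_continuousM IH zp_continuous_id) (zp_continuous_cst c) Za).
by move=> x; rewrite hornerMXaddC.
Qed.

Lemma uniformly_differentiable_ext F G : (forall x, Zp x -> F x = G x) ->
  uniformly_differentiable F -> uniformly_differentiable G.
Proof.
move=> FG dF a Za; have [l ld] := dF a Za; exists l => e e0.
by have [d d0 dl] := ld e e0; exists d => // x y Zx Zy *; rewrite -!FG ?dl.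
Qed.

Lemma uniformly_differentiableP F : uniformly_differentiable F <->
  forall a, Zp a -> exists l,
    vcvg absC (zp_nbhs2 a) (fun z => (F z.1 - F z.2) / i_ (z.1 - z.2)) l.
Proof. by []. Qed.

Lemma zp_nbhs2_fst F a l : vcvg absC (zp_nbhs a) F l ->
  vcvg absC (zp_nbhs2 a) (fun z => F z.1) l.
Proof.
apply: vcvg_comp => A [d d0 dA]; exists d => // x y Zx Zy xy xd yd; exact: dA.
Qed.

Lemma zp_nbhs2_snd F a l : vcvg absC (zp_nbhs a) F l ->
  vcvg absC (zp_nbhs2 a) (fun z => F z.2) l.
Proof.
apply: vcvg_comp => A [d d0 dA]; exists d => // x y Zx Zy xy xd yd; exact: dA.
Qed.

(** By the ultrametric inequality x - y is near 0 as soon as x and y are near the same point. *)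
Lemma zp_nbhs2_sub F a l : vcvg absC (zp_nbhs 0) F l ->
  vcvg absC (zp_nbhs2 a) (fun z => F (z.1 - z.2)) l.
Proof.
apply: vcvg_comp => A [d d0 dA]; exists d => // x y Zx Zy xy xd yd.
apply: dA; first exact: padic_intB.
have := absvD_lt vQ xd (_ : absQ (a - y) < d); rewrite subr0 subrKA; apply.
by rewrite (absvB_sym vQ).
Qed.

Lemma uniformly_differentiable_cst (c : Cp) : uniformly_differentiable (fun _ : Qp => c).
Proof.
apply/uniformly_differentiableP => a _; exists 0.
by apply: vcvg_ext (vcvg_cst vC 0) => z; rewrite subrr mul0r.
Qed.

Lemma uniformly_differentiable_id : uniformly_differentiable i_.
Proof.
apply/uniformly_differentiableP => a _; exists 1.
apply: vcvg_near (vcvg_cst vC 1); exists 1 => // x y _ _ xy _ _ /=.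
by rewrite -rmorphB divff // fmorph_eq0 subr_eq0.
Qed.

Lemma uniformly_differentiableD F G :
  uniformly_differentiable F -> uniformly_differentiable G ->
  uniformly_differentiable (fun x => F x + G x).
Proof.
move=> dF dG; apply/uniformly_differentiableP => a Za.
have [l Fl] := (uniformly_differentiableP F).1 dF a Za.
have [m Gm] := (uniformly_differentiableP G).1 dG a Za; exists (l + m).
apply: vcvg_ext (vcvgD vC Fl Gm) => z; rewrite -mulrDl; congr (_ / _).
by rewrite opprD [RHS]addrACA.
Qed.

(** The product rule, from F(x) (G(x) - G(y)) + (F(x) - F(y)) G(y). *)
Lemma uniformly_differentiableM F G : zp_continuous F -> zp_continuous G ->
  uniformly_differentiable F -> uniformly_differentiable G ->
  uniformly_differentiable (fun x => F x * G x).
Proof.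
move=> cF cG dF dG; apply/uniformly_differentiableP => a Za.
have [l Fl] := (uniformly_differentiableP F).1 dF a Za.
have [m Gm] := (uniformly_differentiableP G).1 dG a Za; exists (F a * m + l * G a).
have Fa := zp_nbhs2_fst (cF a Za); have Ga := zp_nbhs2_snd (cG a Za).
apply: vcvg_ext (vcvgD vC (vcvgM vC Fa Gm) (vcvgM vC Fl Ga)) => z /=.
rewrite mulrA [X in _ + X]mulrAC -mulrDl; congr (_ / _).
by rewrite mulrBr mulrBl addrA subrK.
Qed.

Lemma uniformly_differentiable_horner (h : {poly Cp}) :
  uniformly_differentiable (fun x => h.[i_ x]).
Proof.
elim/poly_ind: h => [|h c IH].
  apply: uniformly_differentiable_ext (uniformly_differentiable_cst 0) => x _.
  by rewrite horner0.
have cX := zp_continuous_id; have ch := zp_continuous_horner h.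
have dc := uniformly_differentiable_cst c.
apply: uniformly_differentiable_ext (uniformly_differentiableD
  (uniformly_differentiableM ch cX IH uniformly_differentiable_id) dc) => x _.
by rewrite hornerMXaddC.
Qed.

Lemma uniformly_differentiable_shift F b : Zp b ->
  uniformly_differentiable F -> uniformly_differentiable (fun x => F (b + x)).
Proof.
move=> Zb dF a Za; have [l Fl] := dF _ (padic_intD Zb Za); exists l => e e0.
have [d d0 dl] := Fl e e0; exists d => // x y Zx Zy xy xd yd.
have -> : x - y = (b + x) - (b + y) by rewrite opprD addrACA subrr add0r.
apply: dl; rewrite ?opprD ?(inj_eq (addrI b)) // 1?addrACA ?subrr ?add0r //.
- exact: padic_intD.
- exact: padic_intD.
Qed.

(** * The power w^a and its fermionic integrals *)

Context (p_odd : odd p) (w : Cp) (w1 : absC (1 - w) < 1).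
Local Notation W := (padic_pow w).
Local Notation u := (w - 1).
Local Notation q := (absC u).

Let q0 : 0 <= q := absval_ge0 vC u.
Let q1 : q < 1. Proof. by rewrite (absvB_sym vC). Qed.

Lemma padic_binomial_nat m n : padic_binomial (m%:R : Qp) n = 'C(m, n)%:R.
Proof.
rewrite /padic_binomial; have -> : \prod_(i < n) (m%:R - i%:R) = (m ^_ n)%:R :> Qp.
  elim: n => [|n IH]; first by rewrite big_ord0.
  rewrite big_ord_recr /= IH ffactnSr natrM.
  by case: (leqP n m) => [nm|mn]; [rewrite natrB|rewrite ffact_small // !mul0r].
by rewrite -bin_ffact natrM mulfK // fact_neq0 //; apply: pchar_Qp.
Qed.

(** Pulling out the factor [a] makes (w^a - 1) / a again a series of polynomials in [a]. *)
Lemma padic_binomialS a n :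
  padic_binomial a n.+1 = a / n.+1%:R * padic_binomial (a - 1) n.
Proof.
rewrite /padic_binomial big_ord_recl /= subr0 factS natrM invfM mulrACA.
congr (_ * (_ * _)); apply: eq_bigr => i _.
by rewrite /bump /= natrD opprD addrA.
Qed.

Lemma zp_continuous_binomial n : zp_continuous (fun a => i_ (padic_binomial a n)).
Proof.
have cP : zp_continuous (fun a => (\prod_(i < n) ('X - i%:R%:P) : {poly Cp}).[i_ a]).
  exact: zp_continuous_horner.
move=> a Za; have := zp_continuousM cP (zp_continuous_cst n`!%:R^-1) Za.
have E x : (\prod_(i < n) ('X - i%:R%:P) : {poly Cp}).[i_ x] * n`!%:R^-1
    = i_ (padic_binomial x n).
  rewrite /padic_binomial rmorphM fmorphV rmorph_nat rmorph_prod horner_prod.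
  by congr (_ * _); apply: eq_bigr => i _; rewrite hornerXsubC rmorphB rmorph_nat.
by rewrite E; apply: vcvg_ext.
Qed.

(** On the naturals the binomial coefficient is an integer; density and continuity carry the bound
    to Z_p. *)
Lemma absCp_binomial_le1 a n : Zp a -> absC (i_ (padic_binomial a n)) <= 1.
Proof.
apply: (zp_continuous_le (zp_continuous_binomial n)) => m.
by rewrite padic_binomial_nat rmorph_nat absv_nat_le1.
Qed.

Definition pow_coef a n : Cp := i_ (padic_binomial a n) * u ^+ n.

Lemma absCp_pow_coef a n : Zp a -> absC (pow_coef a n) <= q ^+ n.
Proof.
move=> Za; rewrite (absvalM vC) absvX // ler_piMl ?exprn_ge0 //.
exact: absCp_binomial_le1.
Qed.

Lemma cvg_q : (fun n => q ^+ n) @ \oo --> (0 : R).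
Proof.
rewrite [X in X @ _](_ : _ = geometric 1 q); last by apply/funext => n; rewrite /= mul1r.
by apply: cvg_geometric; rewrite ger0_norm.
Qed.

Lemma padic_pow_cvg a : Zp a -> vcvg absC \oo (psum (pow_coef a)) (W a).
Proof.
by move=> Za; apply: (vseries_cvg vC cC _ cvg_q) => n; apply: absCp_pow_coef.
Qed.

Lemma zp_continuous_padic_pow : zp_continuous W.
Proof.
move=> a Za.
apply: (@vcvg_vseries _ _ _ vC cC _ _ _ pow_coef _ (fun n => q ^+ n) Zp).
- by exists 1.
- by move=> b n Zb; apply: absCp_pow_coef.
- by move=> n; apply: absCp_pow_coef.
- exact: cvg_q.
- move=> n; exact: zp_continuousM (zp_continuous_binomial n) (zp_continuous_cst _) _ Za.
Qed.

Lemma padic_pow_nat m : W m%:R = w ^+ m.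
Proof.
apply: (vlim_eq vC); apply: vcvg_near (vcvg_cst vC (w ^+ m)).
(* From N = m + 1 on the series has ended, and its partial sum is the binomial expansion of (1 + (w
   - 1))^m. *)
exists m.+1 => // N /= mN; rewrite (big_cat_nat (leq0n m.+1) mN) /=.
rewrite [X in _ = _ + X]big_nat_cond [X in _ = _ + X]big1 ?addr0 => [|n]; last first.
  by case/andP => /andP[mn _] _; rewrite padic_binomial_nat bin_small // rmorph0 mul0r.
rewrite -[in LHS](subrKC 1 w) exprDn big_mkord; apply: eq_bigr => n _.
by rewrite padic_binomial_nat rmorph_nat expr1n mul1r mulr_natl.
Qed.

(** Density is used twice: for natural exponents this is the rule for ordinary powers, then one
    summand at a time becomes p-adic. *)
Lemma padic_powD a b : Zp a -> Zp b -> W (a + b) = W a * W b.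
Proof.
have cW := zp_continuous_padic_pow.
have natD m x : Zp x -> W (m%:R + x) = W m%:R * W x.
  move=> Zx; have Zm := padic_int_nat m.
  apply: (zp_continuous_eq (zp_continuous_shift Zm cW)
    (zp_continuousM (zp_continuous_cst _) cW) _ Zx) => n.
  by rewrite -natrD !padic_pow_nat exprD.
move=> Za Zb; rewrite addrC.
apply: (zp_continuous_eq (zp_continuous_shift Zb cW)
    (zp_continuousM cW (zp_continuous_cst _)) _ Za) => n.
by rewrite addrC natD.
Qed.

(* Terms of the series of (w^a - 1) / a: binom(a, n+1) / a = binom(a-1, n) / (n+1). *)
Definition pow_quot_coef a n : Cp :=
  i_ (padic_binomial (a - 1) n) * (n.+1%:R^-1 * u ^+ n.+1).

Definition pow_quot a : Cp := vlim absC (psum (pow_quot_coef a)).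

Lemma padic_int_sub1 a : Zp a -> Zp (a - 1).
Proof. by move=> Za; apply/padic_intB/(padic_int_nat 1). Qed.

Lemma absCp_pow_quot_coef a n : Zp a ->
  absC (pow_quot_coef a n) <= n.+1%:R * q ^+ n.+1.
Proof.
move=> Za; rewrite !(absvalM vC) absvX // absvV //.
rewrite -[leRHS]mul1r; apply: ler_pM; rewrite ?(absval_ge0 vC) //.
- by rewrite mulr_ge0 ?invr_ge0 ?exprn_ge0 // (absval_ge0 vC).
- exact/absCp_binomial_le1/padic_int_sub1.
- rewrite ler_wpM2r ?exprn_ge0 // -(rmorph_nat i_) absCp_Qp_Cp.
  rewrite -[leRHS]invrK lef_pV2 ?absQp_nat_ge // posrE ?invr_gt0 ?ltr0n //.
  by rewrite (absv_gt0 vQ) ((pcharf0P Qp).1 pchar_Qp).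
Qed.

Lemma pow_quot_cvg a : Zp a -> vcvg absC \oo (psum (pow_quot_coef a)) (pow_quot a).
Proof.
move=> Za; apply: (vseries_cvg vC cC _ (cvg_nat_expr q0 q1)) => n.
exact: absCp_pow_quot_coef.
Qed.

Lemma zp_continuous_pow_quot : zp_continuous pow_quot.
Proof.
move=> a Za.
apply: (@vcvg_vseries _ _ _ vC cC _ _ _ pow_quot_coef _
  (fun n => n.+1%:R * q ^+ n.+1) Zp).
- by exists 1.
- by move=> b n Zb; apply: absCp_pow_quot_coef.
- by move=> n; apply: absCp_pow_quot_coef.
- exact: cvg_nat_expr.
- move=> n; apply: zp_continuousM (zp_continuous_cst _) _ Za.
  move=> b Zb; have ZN1 : Zp (-1) by rewrite -sub0r; apply/padic_int_sub1/(padic_int_nat 0).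
  have := zp_continuous_shift ZN1 (zp_continuous_binomial n) Zb.
  by rewrite addrC; apply: vcvg_ext => x; rewrite addrC.
Qed.

Lemma padic_pow_sub1 a : Zp a -> W a - 1 = i_ a * pow_quot a.
Proof.
move=> Za; apply: (vcvg_unique vC) (vcvgMl vC (i_ a) (pow_quot_cvg Za)).
(* The term of index 0 is 1; dropping it lines up index n + 1 of one series with index n of the
   other. *)
have H : vcvg absC \oo (fun N => psum (pow_coef a) N.+1 - 1) (W a - 1).
  apply: vcvg_comp (vcvgB vC (padic_pow_cvg Za) (vcvg_cst vC 1)) => A [N _ NA].
  by exists N => // n /= Nn; apply/NA/leqW.
apply: vcvg_ext H => N /=.
rewrite /psum big_nat_recl //= /pow_coef /padic_binomial big_ord0 fact0 divr1.
rewrite rmorph1 expr0 mulr1 addrC addKr mulr_sumr; apply: eq_bigr => n _.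
rewrite -/(padic_binomial a n.+1) padic_binomialS /pow_quot_coef.
rewrite !rmorphM fmorphV rmorph_nat; ring.
Qed.

Lemma uniformly_differentiable_padic_pow : uniformly_differentiable W.
Proof.
apply/uniformly_differentiableP => a Za.
(* From W x - W y = W y (W (x - y) - 1), the quotient is W y times [pow_quot (x - y)]. The value
   [pow_quot 0] is the p-adic logarithm of w, since binom(-1, n) = (-1)^n. *)
exists (W a * pow_quot 0); have Z0 := padic_int_nat 0.
have H1 := zp_nbhs2_snd (zp_continuous_padic_pow Za).
have H2 := zp_nbhs2_sub a (zp_continuous_pow_quot Z0).
apply: vcvg_near (vcvgM vC H1 H2); exists 1 => // x y Zx Zy xy _ _ /=.
have Zxy := padic_intB Zx Zy.
have -> : W x - W y = (W (x - y) - 1) * W y.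
  by rewrite mulrBl mul1r -padic_powD // subrK.
rewrite padic_pow_sub1 //.
have i0 : i_ (x - y) != 0 by rewrite fmorph_eq0 subr_eq0.
by rewrite -[_ * _ * W y]mulrA mulrAC divff // mul1r mulrC.
Qed.

(** * Single fermionic integrals by telescoping *)

Lemma fermionic_int_eq_nat F G : (forall m : nat, F m%:R = G m%:R) ->
  fermionic_int F = fermionic_int G.
Proof.
move=> FG; rewrite /fermionic_int; congr vlim; apply/funext => N.
by apply: eq_bigr => m _; rewrite FG.
Qed.

Lemma alternating_sum_telescope (P : nat -> Cp) n :
  \sum_(0 <= m < n) (P m.+1 + P m) * (-1) ^+ m = P 0%N - (-1) ^+ n * P n.
Proof.
elim: n => [|n IH]; first by rewrite big_geq // expr0 mul1r subrr.
by rewrite big_nat_recr //= IH exprS; ring.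
Qed.

Lemma zp_continuous_expp F : zp_continuous F ->
  vcvg absC \oo (fun N => F (p ^ N)%:R) (F 0).
Proof.
move=> cF; apply: vcvg_comp (cF 0 (padic_int_nat 0)) => A [d d0 dA].
have [n nd] := expp_small d0; exists n => // N /= nN.
apply: dA; first exact: padic_int_nat.
rewrite subr0 absQp_expp //; apply: le_lt_trans nd.
have p0 : 0 < p%:R :> R by rewrite ltr0n prime_gt0.
by rewrite lef_pV2 ?posrE ?exprn_gt0 // ler_weXn2l // ler1n prime_gt0.
Qed.

Lemma fermionic_int_telescope F G : zp_continuous G ->
  (forall m : nat, G m.+1%:R + G m%:R = 2 * F m%:R) -> fermionic_int F = G 0.
Proof.
move=> cG GF; have n2 : 2 != 0 :> Cp by rewrite ((pcharf0P Cp).1 pchar_Cp).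
apply: (vlim_eq vC).
have H : vcvg absC \oo (fun N => 2^-1 * (G 0 + G (p ^ N)%:R)) (2^-1 * (G 0 + G 0)).
  exact: vcvgMl (vcvgD vC (vcvg_cst vC _) (zp_continuous_expp cG)).
have E : 2^-1 * (G 0 + G 0) = G 0 by field.
rewrite E in H; apply: vcvg_ext H => N; apply: (mulfI n2); rewrite mulVKf // mulr_sumr.
under eq_bigr => m _ do rewrite mulrA -GF.
(* p^N is odd for every N, so the boundary term at p^N enters with a plus sign. *)
rewrite (alternating_sum_telescope (fun m => G m%:R)) -signr_odd oddX p_odd orbT.
by rewrite expr1 mulN1r opprK.
Qed.

Lemma fermionic_int_padic_pow (h : {poly Cp}) b : Zp b ->
  fermionic_int (fun a => W (b + a) * h.[i_ (b + a)])
  = W b * (dop (euler_factor w) h).[i_ b].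
Proof.
move=> Zb; set P := dop _ h.
pose G x := W x * P.[i_ x].
have cG : zp_continuous G.
  exact: zp_continuousM zp_continuous_padic_pow (zp_continuous_horner _).
rewrite (fermionic_int_telescope (zp_continuous_shift Zb cG)).
  by rewrite addr0.
(* -(w + 1) = (1 - w) - 2, where 2 has absolute value 1 because p is odd and 1 - w has a smaller
   one; hence w + 1 cannot vanish. *)
have w1' : w + 1 != 0.
  have v2 := absCp_two p_odd.
  rewrite -(absv_gt0 vC) -(absvN vC) (_ : - (w + 1) = 1 - w - 2); last by ring.
  rewrite lt_neqAle (absval_ge0 vC) andbT; apply/negP => /eqP v0.
  have : absC 2 < 1.
    rewrite (_ : 2 = (1 - w) - (1 - w - 2)); last by ring.
    by rewrite absvD_lt // (absvN vC) -v0 ltr01.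
  by rewrite v2 ltxx.
move=> m; have Zm := padic_int_nat m; have Zbm := padic_intD Zb Zm.
rewrite /G (_ : b + m.+1%:R = b + m%:R + 1); last by rewrite -natr1 addrA.
have W1 : W 1 = w by have := padic_pow_nat 1; rewrite expr1.
rewrite (padic_powD Zbm (padic_int_nat 1)) W1 mulrCA.
rewrite -(euler_factor_eq h _ pchar_Cp w1') -/P.
by rewrite rmorphD rmorph1; ring.
Qed.

(** * Iterated integrals *)

Lemma tuple_sum_cons k a (t : k.-tuple Qp) : tuple_sum [tuple of a :: t] = a + tuple_sum t.
Proof.
rewrite /tuple_sum big_ord_recl tnth0; congr (_ + _).
by apply: eq_bigr => i _; rewrite tnthS.
Qed.

Lemma poly_integrand_cons (h : {poly Cp}) k b a :
  (fun t : k.-tuple Qp => W (b + tuple_sum [tuple of a :: t]) *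
     h.[i_ (b + tuple_sum [tuple of a :: t])])
  = (fun t : k.-tuple Qp => W (b + a + tuple_sum t) * h.[i_ (b + a + tuple_sum t)]).
Proof. by apply/funext => t; rewrite tuple_sum_cons addrA. Qed.

(** The offset [b] lets the induction close: freezing the outer variable [a] replaces [b] by
    [b + a], and each integration applies T once more. *)
Lemma fermionic_mint_padic_pow k (h : {poly Cp}) b : Zp b ->
  fermionic_mint (fun t : k.-tuple Qp => W (b + tuple_sum t) * h.[i_ (b + tuple_sum t)])
  = W b * (dop (euler_gf w k) h).[i_ b].
Proof.
elim: k b => [|k IH] b Zb.
  by rewrite /= /tuple_sum big_ord0 addr0 dop_euler_gf0.
rewrite dop_euler_gfS -fermionic_int_padic_pow //=.
(* The outer integral samples only naturals, so the induction hypothesis is needed just at the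
   p-adic integers b + m. *)
apply: fermionic_int_eq_nat => m; rewrite poly_integrand_cons IH //.
exact/padic_intD/padic_int_nat.
Qed.

(** The inner integrals are known in closed form, so differentiability reduces to that of a shifted
    product of w^x and a polynomial. *)
Lemma fermionic_mintegrable_padic_pow k (h : {poly Cp}) b : Zp b ->
  fermionic_mintegrable
    (fun t : k.-tuple Qp => W (b + tuple_sum t) * h.[i_ (b + tuple_sum t)]).
Proof.
elim: k b => [//|k IH] b Zb; split => [a Za|].
  by rewrite poly_integrand_cons; apply/IH/padic_intD.
pose P := dop (euler_gf w k) h.
have dW := uniformly_differentiable_padic_pow.
have dP := uniformly_differentiableM zp_continuous_padic_pow
  (zp_continuous_horner P) dW (uniformly_differentiable_horner P).
apply: uniformly_differentiable_ext (uniformly_differentiable_shift Zb dP) => a Za.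
by rewrite poly_integrand_cons fermionic_mint_padic_pow //; apply: padic_intD.
Qed.

End PadicComplex.

(* The first two conjuncts say that the integrals in the identities are well
   defined; the last three are the identities. *)
Theorem theorem2p7 (R : realType) (p : nat) (p_prime : prime p) (p_odd : odd p)
    (C : padic_complex R p) (w : Cp C) (hw : absCp (1 - w) < 1)
    (k : nat) (hk : (1 <= k)%N) :
  (forall n : nat,
     fermionic_mintegrable (fun a : k.-tuple (Qp C) => exp_integrand w a n)) /\
  (forall h : {poly Cp C},
     fermionic_mintegrable (fun a : k.-tuple (Qp C) => poly_integrand w h a)) /\
  (forall h : {poly Cp C},
     umbral_pairing
       (fermionic_mint_fps (fun a : k.-tuple (Qp C) => exp_integrand w a)) h
     = fermionic_mint (fun a : k.-tuple (Qp C) => poly_integrand w h a)) /\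
  (forall h : {poly Cp C},
     umbral_pairing (euler_gf w k) h
     = fermionic_mint (fun a : k.-tuple (Qp C) => poly_integrand w h a)) /\
  (forall n : nat,
     weighted_euler_number w k n
     = umbral_pairing
         (fermionic_mint_fps (fun a : k.-tuple (Qp C) => exp_integrand w a)) 'X^n).
Proof.
have Z0 : padic_int (0 : Qp C) by exact: (padic_int_nat C 0).
have E h : (fun a : k.-tuple (Qp C) => poly_integrand w h a)
    = (fun a => padic_pow w (0 + tuple_sum a) * h.[Qp_Cp (0 + tuple_sum a)]).
  by apply/funext => a; rewrite !add0r.
(* The coefficient of t^n in e^(st) is s^n / n!, so coefficientwise integration is the polynomial
   case for x^n / n!. *)
have Eexp n : (fun a : k.-tuple (Qp C) => exp_integrand w a n)
    = (fun a => poly_integrand w (n`!%:R^-1 *: 'X^n) a).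
  apply/funext => a; rewrite /exp_integrand /fps_scale /fps_exp /poly_integrand.
  by rewrite hornerZ hornerXn; congr (_ * _); rewrite mulrC.
have mintE h : fermionic_mint (fun a : k.-tuple (Qp C) => poly_integrand w h a)
    = umbral_pairing (euler_gf w k) h.
  (* At offset 0 the prefactor is w^0 = 1, and the value of G(D)^k h at 0 is the pairing. *)
  rewrite E (fermionic_mint_padic_pow p_prime p_odd hw) // umbral_pairingE rmorph0.
  by rewrite (padic_pow_nat w 0) expr0 mul1r.
have coefE n : n`!%:R * fermionic_mint (fun a : k.-tuple (Qp C) => exp_integrand w a n)
    = n`!%:R * euler_gf w k n.
  rewrite Eexp mintE !umbral_pairingE dopZ hornerZ -umbral_pairingE umbral_pairingXn.
  by rewrite mulKf // fact_neq0 //; apply: pchar_Cp.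
have pairE h : umbral_pairing
    (fermionic_mint_fps (fun a : k.-tuple (Qp C) => exp_integrand w a)) h
    = umbral_pairing (euler_gf w k) h.
  by apply: eq_bigr => n _; rewrite coefE.
have mintegrable h :
    fermionic_mintegrable (fun a : k.-tuple (Qp C) => poly_integrand w h a).
  by rewrite E; apply: fermionic_mintegrable_padic_pow.
split=> [n|]; first by rewrite Eexp.
split=> //; split=> [h|]; first by rewrite pairE mintE.
split=> [h|n]; first by rewrite mintE.
by rewrite pairE umbral_pairingXn weighted_euler_numberE.
Qed.
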